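(* Let $m\le n$, let $Y\in\mathbb{R}^{m\times n}$, and for $\lambda>0$ let $\widehat{X}(\lambda)=\operatorname{SVT}_\lambda(Y)$, the solution of $\min_{X\in\mathbb{R}^{m\times n}}\|X\|_*+\frac{1}{2\lambda}\|X-Y\|_F^2$ obtained by applying the singular value thresholding operator to $Y$. Let $\eta>0$ be such that $\|Y\|_F^2>\eta$. Then the nonlinear equation $\|Y-\widehat{X}(\lambda)\|_F^2=\eta$ has a unique solution $\lambda>0$.
   Context: $\|\cdot\|_F$ is the Frobenius norm and $\|X\|_*$ is the nuclear norm (sum of the singular values of $X$). Write a singular value decomposition $Y=\sum_{i=1}^m\sigma_{Y,i}\mathbf{u}_i\mathbf{v}_i^T$ with $\sigma_{Y,1}\ge\cdots\ge\sigma_{Y,m}\ge 0$, orthonormal left singular vectors $\mathbf{u}_i\in\mathbb{R}^m$ and orthonormal right singular vectors $\mathbf{v}_i\in\mathbb{R}^n$. With $(x)_+=\max(x,0)$, the singular value thresholding operator is $\operatorname{SVT}_\lambda(Y)=\sum_{i=1}^m(\sigma_{Y,i}-\lambda)_+\mathbf{u}_i\mathbf{v}_i^T$. *)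

(* Defs.v *)
From HB Require Import structures.
From mathcomp Require Import all_boot all_order all_algebra.
From mathcomp Require Import all_classical reals.

Set Implicit Arguments.
Unset Strict Implicit.
Unset Printing Implicit Defensive.
Import Order.TTheory GRing.Theory Num.Theory.
Local Open Scope classical_set_scope.
Local Open Scope ring_scope.

(* MathComp-Analysis puts the maximum norm on matrices, so its [`|A|] is not
   the Frobenius norm. *)
Definition frobenius_norm (R : realType) m n (A : 'M[R]_(m, n)) : R :=
  Num.sqrt (\sum_(i < m) \sum_(j < n) A i j ^+ 2).

(* [(u i)^T *m u j] is a 1 x 1 matrix. *)
Definition orthonormal_family (R : realType) k d (u : 'I_k -> 'cV[R]_d) : Prop :=
  forall i j, (u i)^T *m u j = (i == j)%:R%:M.

(* Thin SVD of a wide matrix: it has m terms, so it exists only if m <= n. *)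
Definition is_svd (R : realType) m n (Y : 'M[R]_(m, n)) (s : 'rV[R]_m)
    (u : 'I_m -> 'cV[R]_m) (v : 'I_m -> 'cV[R]_n) : Prop :=
  [/\ forall i j : 'I_m, (i <= j)%N -> s 0 j <= s 0 i,
      forall i, 0 <= s 0 i,
      orthonormal_family u,
      orthonormal_family v
    & Y = \sum_(i < m) s 0 i *: (u i *m (v i)^T)].

(* The singular values do not depend on the chosen decomposition; the default
   value 0 is reached only if m > n. *)
Definition singular_values (R : realType) m n (X : 'M[R]_(m, n)) : 'rV[R]_m :=
  xget 0 [set s | exists u v, is_svd X s u v].

Definition nuclear_norm (R : realType) m n (X : 'M[R]_(m, n)) : R :=
  \sum_(i < m) singular_values X 0 i.

(* Singular value thresholding of the matrix with singular value decomposition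
   [(s, u, v)]. *)
Definition svt (R : realType) m n (lambda : R) (s : 'rV[R]_m)
    (u : 'I_m -> 'cV[R]_m) (v : 'I_m -> 'cV[R]_n) : 'M[R]_(m, n) :=
  \sum_(i < m) Num.max (s 0 i - lambda) 0 *: (u i *m (v i)^T).

Definition svt_objective (R : realType) m n (lambda : R) (Y X : 'M[R]_(m, n)) : R :=
  nuclear_norm X + (2 * lambda)^-1 * frobenius_norm (X - Y) ^+ 2.

Definition is_minimizer (R : realType) (T : Type) (f : T -> R) (x : T) : Prop :=
  forall y, f x <= f y.

(* Main.v *)
(** A singular value decomposition of an arbitrary matrix X is built one triple
    at a time: maximise <x, X y> over unit vectors orthogonal to the singular
    vectors already found (a compact set); by the equality case of
    Cauchy-Schwarz a maximiser is a pair of singular vectors.  By Bessel's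
    inequality <W, X> is at most the sum of the singular values whenever W is a
    combination of orthonormal dyads with weights in [0, 1], with equality for
    W = sum u_i v_i^T, so the nuclear norm does not depend on the decomposition.

    With Z = SVT(Y), the matrix W = (Y - Z) / lambda has weights
    min(s_i, lambda) / lambda in [0, 1] and <W, Z> = |Z|_*, whence for every X
    the objective at X exceeds that at Z by at least
    |X - Z|_F^2 / (2 lambda).

    The residual |Y - Z|_F^2 = sum min(s_i, lambda)^2 is continuous in lambda,
    vanishes at 0, reaches |Y|_F^2, and is strictly increasing as long as it is
    below |Y|_F^2. *)
Require Import Defs.
From mathcomp Require Import all_boot all_order all_algebra.
From mathcomp Require Import all_classical reals.
From mathcomp Require Import topology normedtype derive.
From mathcomp Require Import ring lra.

Set Implicit Arguments.
Unset Strict Implicit.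
Unset Printing Implicit Defensive.
Import Order.TTheory GRing.Theory Num.Theory.
Import numFieldNormedType.Exports.
Local Open Scope ring_scope.

(** * The Frobenius inner product and Bessel's inequality *)

Definition mxip (R : realType) p q (A B : 'M[R]_(p, q)) : R := \tr (A^T *m B).

Section InnerProduct.
Context {R : realType}.

Lemma mxipE p q (A B : 'M[R]_(p, q)) :
  mxip A B = \sum_i \sum_j A i j * B i j.
Proof.
rewrite /mxip /mxtrace exchange_big /=; apply: eq_bigr => j _.
by rewrite mxE; apply: eq_bigr => i _; rewrite mxE.
Qed.

Lemma mxipC p q (A B : 'M[R]_(p, q)) : mxip A B = mxip B A.
Proof. by rewrite /mxip -mxtrace_tr trmx_mul trmxK. Qed.

Lemma mxipDr p q (A B C : 'M[R]_(p, q)) :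
  mxip A (B + C) = mxip A B + mxip A C.
Proof. by rewrite /mxip mulmxDr mxtraceD. Qed.

Lemma mxipZr p q a (A B : 'M[R]_(p, q)) : mxip A (a *: B) = a * mxip A B.
Proof. by rewrite /mxip -scalemxAr mxtraceZ. Qed.

Lemma mxip0r p q (A : 'M[R]_(p, q)) : mxip A 0 = 0.
Proof. by rewrite /mxip mulmx0 mxtrace0. Qed.

Lemma mxipBr p q (A B C : 'M[R]_(p, q)) :
  mxip A (B - C) = mxip A B - mxip A C.
Proof. by rewrite -scaleN1r mxipDr mxipZr mulN1r. Qed.

Lemma mxipZl p q a (A B : 'M[R]_(p, q)) : mxip (a *: A) B = a * mxip A B.
Proof. by rewrite mxipC mxipZr mxipC. Qed.

Lemma mxipBl p q (A B C : 'M[R]_(p, q)) :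
  mxip (A - B) C = mxip A C - mxip B C.
Proof. by rewrite mxipC mxipBr !(mxipC C). Qed.

Lemma mxip_sumr p q (I : finType) (A : 'M[R]_(p, q)) (F : I -> 'M[R]_(p, q)) :
  mxip A (\sum_i F i) = \sum_i mxip A (F i).
Proof. exact: (big_morph _ (mxipDr A) (mxip0r A)). Qed.

Lemma mxip_suml p q (I : finType) (A : 'M[R]_(p, q)) (F : I -> 'M[R]_(p, q)) :
  mxip (\sum_i F i) A = \sum_i mxip (F i) A.
Proof. by rewrite mxipC mxip_sumr; apply: eq_bigr => i _; rewrite mxipC. Qed.

Lemma mxip_mulr p q r (A : 'M[R]_(p, q)) (M : 'M[R]_(p, r)) (B : 'M[R]_(r, q)) :
  mxip A (M *m B) = mxip (M^T *m A) B.
Proof. by rewrite /mxip trmx_mul trmxK mulmxA. Qed.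

Lemma mxip_dyadl p q (x : 'cV[R]_p) (y : 'cV[R]_q) (B : 'M[R]_(p, q)) :
  mxip (x *m y^T) B = mxip x (B *m y).
Proof. by rewrite /mxip trmx_mul trmxK -mulmxA mxtrace_mulC mulmxA. Qed.

Lemma mul_dyad p q (x : 'cV[R]_p) (y z : 'cV[R]_q) :
  x *m y^T *m z = mxip y z *: x.
Proof.
rewrite -mulmxA [y^T *m z]mx11_scalar mul_mx_scalar.
by rewrite /mxip [in RHS](mx11_scalar (y^T *m z)) mxtrace_scalar.
Qed.

Lemma mxip_dyad p q (x x' : 'cV[R]_p) (y y' : 'cV[R]_q) :
  mxip (x *m y^T) (x' *m y'^T) = mxip x x' * mxip y y'.
Proof. by rewrite mxip_dyadl mul_dyad mxipZr mulrC (mxipC y'). Qed.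

Lemma mxip_ge0 p q (A : 'M[R]_(p, q)) : 0 <= mxip A A.
Proof.
by rewrite mxipE; do 2!apply: sumr_ge0 => ? _; rewrite -expr2 sqr_ge0.
Qed.

Lemma mxip_eq0 p q (A : 'M[R]_(p, q)) : mxip A A = 0 -> A = 0.
Proof.
rewrite mxipE => /eqP.
have sge i : 0 <= \sum_j A i j * A i j.
  by apply: sumr_ge0 => j _; rewrite -expr2 sqr_ge0.
rewrite psumr_eq0 // => /allP A0; apply/matrixP => i j; rewrite mxE.
have := A0 i (mem_index_enum _); rewrite /= psumr_eq0 => [|k _]; last first.
  by rewrite -expr2 sqr_ge0.
by move=> /allP /(_ j (mem_index_enum _)) /=; rewrite mulf_eq0 orbb => /eqP.
Qed.

Lemma sqr_frobenius_norm p q (A : 'M[R]_(p, q)) :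
  frobenius_norm A ^+ 2 = mxip A A.
Proof.
rewrite /frobenius_norm sqr_sqrtr; last first.
  by do 2!apply: sumr_ge0 => ? _; rewrite sqr_ge0.
by rewrite mxipE; under eq_bigr do under eq_bigr do rewrite expr2.
Qed.

Lemma orthonormal_familyE k d (u : 'I_k -> 'cV[R]_d) :
  orthonormal_family u <-> forall i j, mxip (u i) (u j) = (i == j)%:R.
Proof.
split=> hu i j; first by rewrite /mxip hu mxtrace_scalar.
by rewrite [_ *m _]mx11_scalar -trace_mx11 -/(mxip _ _) hu.
Qed.

(** Expand the squared norm of [x - p], where [p] is the projection of [x] onto the span: <p, x> and
    <p, p> both equal the left-hand sum. *)
Lemma bessel k d (u : 'I_k -> 'cV[R]_d) (x : 'cV[R]_d) :
  orthonormal_family u -> \sum_i mxip (u i) x ^+ 2 <= mxip x x.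
Proof.
move=> /orthonormal_familyE hu; set p := \sum_i mxip (u i) x *: u i.
have px : mxip p x = \sum_i mxip (u i) x ^+ 2.
  by rewrite mxip_suml; apply: eq_bigr => i _; rewrite mxipZl expr2.
have pp : mxip p p = \sum_i mxip (u i) x ^+ 2.
  rewrite [in LHS]mxip_suml; apply: eq_bigr => i _.
  rewrite mxipZl expr2; congr (_ * _); rewrite mxip_sumr (bigD1 i) //=.
  rewrite mxipZr hu eqxx mulr1 big1 ?addr0 // => j /negPf ij.
  by rewrite mxipZr hu eq_sym ij mulr0.
have := mxip_ge0 (x - p); rewrite mxipBl !mxipBr (mxipC x p) px pp; lra.
Qed.

End InnerProduct.

(** * Existence of a singular value decomposition *)

Section SingularPairs.
Context {R : realType}.

Lemma continuous_mxip (T : topologicalType) p q (f g : T -> 'M[R]_(p, q)) :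
  (forall i j, continuous (fun t => f t i j)) ->
  (forall i j, continuous (fun t => g t i j)) ->
  continuous (fun t => mxip (f t) (g t)).
Proof.
move=> cf cg; under eq_fun do rewrite mxipE.
apply: continuous_big => [|i _]; first exact: add_continuous.
apply: continuous_big => [|j _ t]; first exact: add_continuous.
by apply: continuousM; [exact: cf|exact: cg].
Qed.

(** Feasible set for the next singular vector. Indexing the family by [nat] lets the induction on
    [k] extend it without casts between ordinal types. *)
Definition unit_perp k d (u : nat -> 'cV[R]_d) : set 'cV[R]_d :=
  [set x | mxip x x = 1 /\ forall i, (i < k)%N -> mxip (u i) x = 0]%classic.

(* Rows rather than columns, because the compactness criterion of the library
   is for row vectors. *)
Lemma compact_unit_perp k d (u : nat -> 'cV[R]_d) :
  compact [set x : 'rV[R]_d | unit_perp k u x^T]%classic.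
Proof.
have ctr i j : continuous (fun x : 'rV[R]_d => x^T i j).
  by under eq_fun do rewrite mxE; exact: coord_continuous.
have closed_level (f : 'rV[R]_d -> R) c :
    continuous f -> closed [set x | f x = c]%classic.
  move=> cf; pose C : set R := [set x | x = c]%classic.
  have cC : closed C by exact: closed_eq.
  exact: (@preimage_closed _ _ f C (fun x _ => cf x) cC).
(* Entries of a unit vector lie in [-1, 1], so the set is a closed part of a compact cube. *)
have cube := @rV_compact R d (fun=> `[-1, 1]%classic)
  (fun=> @segment_compact R (-1) 1).
apply: subclosed_compact cube _.
- apply: closedI; first by apply: closed_level; exact: continuous_mxip.
  rewrite [X in closed X](_ : _ = \bigcap_(i in [set i | (i < k)%N])
      [set x : 'rV[R]_d | mxip (u i) x^T = 0])%classic //.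
  apply: closed_bigI => i _; apply: closed_level.
  by apply: continuous_mxip => // a b; exact: cst_continuous.
- move=> x [x1 _] i /=; rewrite in_itv /= -ler_norml -(@expr_le1 _ 2) //.
  rewrite real_normK ?num_real // -x1 mxipE (bigD1 i) //= big_ord1 !mxE expr2.
  rewrite lerDl sumr_ge0 // => j _.
  by rewrite big_ord1 -expr2 sqr_ge0.
Qed.

(** A matrix with [k < d] columns has a nonzero left kernel; normalise one of its vectors. *)
Lemma unit_perp_nonempty k d (u : nat -> 'cV[R]_d) :
  (k < d)%N -> exists x, unit_perp k u x.
Proof.
move=> kd; pose U := \matrix_(i < d, j < k) u j i 0.
have : kermx U != 0.
  rewrite -mxrank_eq0 mxrank_ker -lt0n subn_gt0.
  exact: leq_ltn_trans (rank_leq_col U) kd.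
move=> /rowV0Pn [x /sub_kermxP xU x0].
have r0 : 0 < mxip x^T x^T.
  rewrite lt_neqAle mxip_ge0 andbT eq_sym; apply: contra x0 => /eqP /mxip_eq0.
  by move=> /(congr1 trmx); rewrite trmxK trmx0 => ->.
exists ((Num.sqrt (mxip x^T x^T))^-1 *: x^T); split.
  rewrite mxipZl mxipZr mulrA -expr2 exprVn sqr_sqrtr ?ltW // mulVf //.
  by rewrite gt_eqF.
move=> i ik; rewrite mxipZr mxipC.
suff -> : mxip x^T (u i) = (x *m U) 0 (Ordinal ik) by rewrite xU mxE mulr0.
by rewrite mxipE mxE; apply: eq_bigr => j _; rewrite big_ord1 !mxE.
Qed.

Lemma bilinear_max k m n (u : nat -> 'cV[R]_m) (v : nat -> 'cV[R]_n)
    (X : 'M[R]_(m, n)) : (k < m)%N -> (k < n)%N ->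
  exists a b, [/\ unit_perp k u a, unit_perp k v b &
    forall x y, unit_perp k u x -> unit_perp k v y ->
      mxip x (X *m y) <= mxip a (X *m b)].
Proof.
move=> /(unit_perp_nonempty u) [x0 hx0] /(unit_perp_nonempty v) [y0 hy0].
pose f (t : 'rV[R]_m * 'rV[R]_n) := mxip t.1^T (X *m t.2^T).
have c1 i j : continuous (fun t : 'rV[R]_m * 'rV[R]_n => t.1^T i j).
  under eq_fun do rewrite mxE; move=> t.
  apply: (@continuous_comp _ _ _ fst (fun x : 'rV[R]_m => x j i)).
    exact: cvg_fst.
  exact: coord_continuous.
have c2 i j : continuous (fun t : 'rV[R]_m * 'rV[R]_n => t.2^T i j).
  under eq_fun do rewrite mxE; move=> t.
  apply: (@continuous_comp _ _ _ snd (fun x : 'rV[R]_n => x j i)).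
    exact: cvg_snd.
  exact: coord_continuous.
have cf : continuous f.
  apply: continuous_mxip => // i j; under eq_fun do rewrite mxE.
  apply: continuous_big => [|l _ t]; first exact: add_continuous.
  by apply: continuousM; [exact: cst_continuous|exact: c2].
pose A := [set x : 'rV[R]_m | unit_perp k u x^T]%classic.
pose B := [set x : 'rV[R]_n | unit_perp k v x^T]%classic.
have cAB : compact (A `*` B)%classic.
  by apply: compact_setX; exact: compact_unit_perp.
have AB0 : (A `*` B !=set0)%classic.
  by exists (x0^T, y0^T); split; rewrite /A /B /= trmxK.
have [[a b] /set_mem [/= ha hb] hmax] :=
  @compact_EVT_max _ R f _ AB0 cAB (continuous_subspaceT cf).
exists a^T, b^T; split=> // x y hx hy.
have := hmax (x^T, y^T); rewrite /f /= !trmxK; apply.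
by apply/mem_set; split; rewrite /A /B /= trmxK.
Qed.

(* The equality case of the Cauchy-Schwarz inequality. *)
Lemma unit_argmax_colinear d (P : 'cV[R]_d -> Prop) (z a : 'cV[R]_d) :
  mxip a a = 1 -> (forall c, P (c *: z)) ->
  (forall x, mxip x x = 1 -> P x -> mxip x z <= mxip a z) ->
  z = mxip a z *: a.
Proof.
move=> a1 Pz max_a; have z_ge0 := mxip_ge0 z.
have [/mxip_eq0 ->|z0] := eqVneq (mxip z z) 0; first by rewrite mxip0r scale0r.
pose r := Num.sqrt (mxip z z).
have r2 : mxip z z = r ^+ 2 by rewrite sqr_sqrtr.
have r0 : 0 < r by rewrite sqrtr_gt0 lt_neqAle eq_sym z0.
(* Maximality is tested at the unit vector z / |z|. *)
have rz : r <= mxip a z.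
  have := max_a _ _ (Pz r^-1); rewrite mxipZr !mxipZl r2.
  have -> : r^-1 * r ^+ 2 = r by rewrite expr2 mulKf // gt_eqF.
  by rewrite mulVf ?gt_eqF //; apply.
(* The squared norm of the difference is r^2 - <a, z>^2, which is at most 0. *)
apply/eqP; rewrite -subr_eq0; apply/eqP/mxip_eq0/eqP.
rewrite eq_le mxip_ge0 andbT mxipBl !mxipBr !(mxipZl, mxipZr) a1 r2 (mxipC z).
nra.
Qed.

(* The last clause, maximality, is what makes the next singular value at most
   the previous ones. *)
Lemma partial_svd m n (X : 'M[R]_(m, n)) k : (k <= m)%N -> (m <= n)%N ->
  exists (s : nat -> R) (u : nat -> 'cV[R]_m) (v : nat -> 'cV[R]_n),
  [/\ forall i j, (i <= j < k)%N -> s j <= s i,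
      forall i, (i < k)%N -> 0 <= s i,
      forall i j, (i < k)%N -> (j < k)%N ->
        mxip (u i) (u j) = (i == j)%:R /\ mxip (v i) (v j) = (i == j)%:R,
      forall i, (i < k)%N -> X *m v i = s i *: u i /\ X^T *m u i = s i *: v i
    & forall i x y, (i < k)%N -> unit_perp k u x -> unit_perp k v y ->
        mxip x (X *m y) <= s i].
Proof.
elim: k => [|k IHk] km mn.
  by exists (fun=> 0), (fun=> 0), (fun=> 0); split=> // i j /andP[].
have [s [u [v [s_dec s_ge0 uv Xuv s_max]]]] := IHk (ltnW km) mn.
have [a [b [ha hb ab_max]]] := bilinear_max u v X km (leq_trans km mn).
have [a1 ua] := ha; have [b1 vb] := hb.
pose sg := mxip a (X *m b).
(* <u_i, X b> = <X^T u_i, b> = s_i <v_i, b> = 0, so every multiple of [X *m b] satisfies the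
   orthogonality constraints. *)
have Xb : X *m b = sg *: a.
  apply: (@unit_argmax_colinear _
      (fun x => forall i, (i < k)%N -> mxip (u i) x = 0)) => //.
    move=> c i ik; rewrite mxipZr mxip_mulr (Xuv i ik).2 mxipZl vb //.
    by rewrite !mulr0.
  by move=> x x1 ux; exact: ab_max.
have Xa : X^T *m a = sg *: b.
  have -> : sg = mxip b (X^T *m a) by rewrite mxip_mulr trmxK mxipC.
  apply: (@unit_argmax_colinear _
      (fun x => forall i, (i < k)%N -> mxip (v i) x = 0)) => //.
    move=> c i ik; rewrite mxipZr mxip_mulr trmxK (Xuv i ik).1 mxipZl ua //.
    by rewrite !mulr0.
  move=> y y1 vy; rewrite !mxip_mulr !trmxK !(mxipC _ a).
  exact: ab_max.
(* [- a] is feasible as well, so -sg <= sg. *)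
have sg_ge0 : 0 <= sg.
  have : mxip (- a) (X *m b) <= sg.
    apply: ab_max => //; rewrite -scaleN1r; split=> [|i ik].
      by rewrite mxipZl mxipZr a1; ring.
    by rewrite mxipZr ua // mulr0.
  by rewrite -scaleN1r mxipZl -/sg; lra.
pose ext T (f : nat -> T) c i := if (i < k)%N then f i else c.
have ext_lt T (f : nat -> T) c i : (i < k)%N -> ext T f c i = f i.
  by rewrite /ext => ->.
have ext_k T (f : nat -> T) c : ext T f c k = c by rewrite /ext ltnn.
have perp_ext d (w : nat -> 'cV[R]_d) c x :
    unit_perp k.+1 (ext _ w c) x -> unit_perp k w x.
  move=> [x1 wx]; split=> // i ik.
  by rewrite -(wx i (ltnW ik)) ext_lt.
exists (ext _ s sg), (ext _ u a), (ext _ v b); split.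
- move=> i j /andP[ij]; rewrite ltnS leq_eqVlt => /orP[/eqP jk|jk].
    move: ij; rewrite jk leq_eqVlt ext_k => /orP[/eqP -> |ik].
      by rewrite ext_k.
    (* The pair [a], [b] is feasible at stage [k], where the maximality clause bounds [sg] by every
       earlier value. *)
    by rewrite ext_lt //; exact: s_max.
  by rewrite !ext_lt ?(leq_ltn_trans ij) // s_dec // ij.
- move=> i; rewrite ltnS leq_eqVlt => /orP[/eqP ->|ik]; first by rewrite ext_k.
  by rewrite ext_lt // s_ge0.
- move=> i j; rewrite !ltnS (leq_eqVlt i) (leq_eqVlt j).
  move=> /orP[/eqP ->|ik] /orP[/eqP ->|jk]; rewrite ?ext_k ?ext_lt //.
  + by rewrite eqxx.
  + by rewrite (mxipC a) (mxipC b) ua // vb // gtn_eqF.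
  + by rewrite ua // vb // ltn_eqF.
  + exact: uv.
- move=> i; rewrite ltnS leq_eqVlt => /orP[/eqP ->|ik].
    by rewrite !ext_k.
  by rewrite !ext_lt //; exact: Xuv.
- move=> i x y; rewrite ltnS leq_eqVlt => ik /perp_ext hx /perp_ext hy.
  case/orP: ik => [/eqP ->|ik]; first by rewrite ext_k; exact: ab_max.
  by rewrite ext_lt //; exact: s_max.
Qed.

(** At stage [m] the left vectors form an orthonormal basis, so X = sum u_i u_i^T X, and u_i^T X =
    s_i v_i^T. *)
Lemma svd_exists m n (X : 'M[R]_(m, n)) : (m <= n)%N ->
  exists s u v, is_svd X s u v.
Proof.
move=> mn; have [s [u [v [s_dec s_ge0 uv Xuv _]]]] := partial_svd X (leqnn m) mn.
have hu : orthonormal_family (fun i : 'I_m => u i).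
  by apply/orthonormal_familyE => i j; rewrite (uv i j _ _).1.
exists (\row_i s i), (fun i => u i), (fun i => v i); split=> //.
- by move=> i j ij; rewrite !mxE s_dec // ij ltn_ord.
- by move=> i; rewrite mxE s_ge0.
- by apply/orthonormal_familyE => i j; rewrite (uv i j _ _).2.
have id_u : \sum_(i < m) u i *m (u i)^T = 1%:M.
  pose U := \matrix_(i < m, j < m) u j i 0.
  have UU : U^T *m U = 1%:M.
    apply/matrixP => i j; rewrite !mxE -(uv i j _ _).1 // mxipE.
    by apply: eq_bigr => l _; rewrite big_ord1 !mxE.
  (* [U] is square, so U^T U = 1 gives U U^T = 1. *)
  rewrite -(mulmx1C UU); apply/matrixP => i j; rewrite summxE mxE.
  by apply: eq_bigr => l _; rewrite !mxE big_ord1 !mxE.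
rewrite -[LHS]mul1mx -id_u mulmx_suml; apply: eq_bigr => i _.
rewrite mxE -mulmxA -[X in _ *m (_ *m X)]trmxK -trmx_mul (Xuv i _).2 //.
by rewrite linearZ /= -scalemxAr.
Qed.

End SingularPairs.

(** * Weighted sums of orthonormal dyads and the nuclear norm *)

Section WeightedDyads.
Context {R : realType} {m n : nat}.
Implicit Types (u : 'I_m -> 'cV[R]_m) (v : 'I_m -> 'cV[R]_n) (w : 'I_m -> R).

Definition dyad_sum w u v : 'M[R]_(m, n) := \sum_i w i *: (u i *m (v i)^T).

Lemma mxip_dyad_sum w w' u v :
  orthonormal_family u -> orthonormal_family v ->
  mxip (dyad_sum w u v) (dyad_sum w' u v) = \sum_i w i * w' i.
Proof.
move=> /orthonormal_familyE hu /orthonormal_familyE hv.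
rewrite mxip_suml; apply: eq_bigr => i _.
rewrite mxipZl mxip_sumr (bigD1 i) //= mxipZr mxip_dyad hu hv eqxx !mulr1.
rewrite big1 ?addr0 // => j /negPf ij.
by rewrite mxipZr mxip_dyad hu hv eq_sym ij mul0r mulr0.
Qed.

(** Operator norm at most 1, in a form free of square roots: 2 w a b <= a^2 + b^2 for each dyad,
    then Bessel on both sides. *)
Lemma dyad_sum_contraction w u v (x : 'cV[R]_m) (y : 'cV[R]_n) :
  (forall i, 0 <= w i <= 1) -> orthonormal_family u -> orthonormal_family v ->
  2 * mxip x (dyad_sum w u v *m y) <= mxip x x + mxip y y.
Proof.
move=> hw hu hv; apply: (@le_trans _ _ (\sum_i mxip (u i) x ^+ 2 +
    \sum_i mxip (v i) y ^+ 2)); last by rewrite lerD // bessel.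
rewrite mulmx_suml mxip_sumr mulr_sumr -big_split /=; apply: ler_sum => i _.
rewrite -scalemxAl mul_dyad !mxipZr (mxipC x).
set a := mxip (u i) x; set b := mxip (v i) y; have /andP[w0 w1] := hw i.
have [ab|ab] := leP 0 (a * b).
  have := ler_wpM2r ab w1; have := sqr_ge0 (a - b); rewrite sqrrB; nra.
have := mulr_ge0_le0 w0 (ltW ab); have := sqr_ge0 a; have := sqr_ge0 b; nra.
Qed.

(** Half of the duality between operator and nuclear norm: each dyad in the decomposition of [X] has
    inner product at most 1 with a contraction. *)
Lemma mxip_dyad_sum_le w u v (X : 'M[R]_(m, n)) s u' v' :
  (forall i, 0 <= w i <= 1) -> orthonormal_family u -> orthonormal_family v ->
  is_svd X s u' v' -> mxip (dyad_sum w u v) X <= \sum_i s 0 i.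
Proof.
move=> hw hu hv [_ s0 /orthonormal_familyE hu' /orthonormal_familyE hv' ->].
rewrite mxip_sumr; apply: ler_sum => i _.
rewrite mxipZr -[leRHS]mulr1; apply: ler_wpM2l => //.
rewrite mxipC mxip_dyadl.
have := dyad_sum_contraction (u' i) (v' i) hw hu hv.
by rewrite hu' hv' !eqxx mulr1n; lra.
Qed.

(** With all weights 1, the dyads of one decomposition attain its sum, which is bounded by the sum
    of any other; then exchange the two. *)
Lemma nuclear_normE (X : 'M[R]_(m, n)) s u v :
  is_svd X s u v -> nuclear_norm X = \sum_i s 0 i.
Proof.
have hw (i : 'I_m) : 0 <= (1 : R) <= 1 by rewrite ler01 lexx.
have le_svd s1 u1 v1 s2 u2 v2 : is_svd X s1 u1 v1 -> is_svd X s2 u2 v2 ->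
    \sum_i s1 0 i <= \sum_i s2 0 i.
  move=> X1; case: (X1) => [_ _ hu1 hv1 X1E] X2.
  have := mxip_dyad_sum_le hw hu1 hv1 X2.
  rewrite [X in mxip _ X]X1E mxip_dyad_sum //.
  by under eq_bigr do rewrite mul1r.
move=> Xs; rewrite /nuclear_norm /singular_values.
(* The default value of [xget] is excluded because [s] belongs to the set. *)
case: xgetP => [_ -> [u' [v' Xs']]|/(_ s) /=]; last by case; exists u, v.
by apply/eqP; rewrite eq_le; apply/andP; split; apply: le_svd; eassumption.
Qed.

End WeightedDyads.

(** * Optimality of singular value thresholding *)

Section Optimality.
Context {R : realType} {m n : nat}.
Context (Y : 'M[R]_(m, n)) (s : 'rV[R]_m).
Context (u : 'I_m -> 'cV[R]_m) (v : 'I_m -> 'cV[R]_n) (hY : is_svd Y s u v).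

Lemma svt_residual lambda :
  Y - svt lambda s u v = dyad_sum (fun i => Num.min (s 0 i) lambda) u v.
Proof.
case: hY => _ _ _ _ ->; rewrite -sumrB; apply: eq_bigr => i _.
rewrite -scalerBl; congr (_ *: _); have [sl|sl] := leP (s 0 i) lambda.
  by rewrite max_r ?subr0 // subr_le0.
by rewrite max_l ?subr_ge0 1?ltW // opprB addrC subrK.
Qed.

(** Thresholding is monotone and nonnegative, so the same vectors give a decomposition of the
    result. *)
Lemma nuclear_norm_svt lambda :
  nuclear_norm (svt lambda s u v) = \sum_i Num.max (s 0 i - lambda) 0.
Proof.
case: hY => s_dec s_ge0 hu hv _.
rewrite (@nuclear_normE _ _ _ _ (\row_i Num.max (s 0 i - lambda) 0) u v).
  by apply: eq_bigr => i _; rewrite mxE.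
split=> //.
- move=> i j ij; rewrite !mxE ge_max !le_max lexx !orbT andbT.
  by rewrite lerD2r s_dec.
- by move=> i; rewrite mxE le_max lexx orbT.
- by apply: eq_bigr => i _; rewrite mxE.
Qed.

(* [lambda^-1 *: (Y - svt lambda s u v)] is a subgradient of the nuclear norm
   at [svt lambda s u v]; strong convexity of the quadratic term then gives the
   last summand. *)
Lemma svt_objective_gap lambda X s' u' v' : 0 < lambda -> is_svd X s' u' v' ->
  svt_objective lambda Y (svt lambda s u v) +
    (2 * lambda)^-1 * mxip (X - svt lambda s u v) (X - svt lambda s u v)
  <= svt_objective lambda Y X.
Proof.
move=> l0 hX; have l_neq0 : lambda != 0 by rewrite gt_eqF.
case: (hY) => _ s_ge0 hu hv _.
pose w i := lambda^-1 * Num.min (s 0 i) lambda.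
pose W := dyad_sum w u v; set Z := svt lambda s u v.
have YZ : Y - Z = lambda *: W.
  rewrite svt_residual scaler_sumr; apply: eq_bigr => i _.
  by rewrite scalerA /w mulrA mulfV // mul1r.
have hw i : 0 <= w i <= 1.
  apply/andP; split.
    by rewrite mulr_ge0 ?invr_ge0 ?le_min ?s_ge0 // ltW.
  by rewrite /w ler_pdivrMl // mulr1 ge_min lexx orbT.
have WX := mxip_dyad_sum_le hw hu hv hX.
(* Complementarity: [Z] has a nonzero weight only where s_i > lambda, and there [w] is 1. *)
have WZ : mxip W Z = nuclear_norm Z.
  rewrite nuclear_norm_svt mxip_dyad_sum //; apply: eq_bigr => i _.
  rewrite /w; have [sl|sl] := leP (s 0 i) lambda.
    by rewrite max_r ?subr_le0 // mulr0.
  by rewrite mulVf // mul1r.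
rewrite /svt_objective (nuclear_normE hX) !sqr_frobenius_norm.
have -> : X - Y = (X - Z) - lambda *: W by rewrite -YZ opprB addrA subrK.
have -> : Z - Y = - 1 *: (lambda *: W) by rewrite -YZ scaleN1r opprB.
have: mxip W (X - Z) = mxip W X - nuclear_norm Z by rewrite mxipBr WZ.
move: (X - Z) => D WD.
rewrite !(mxipBl, mxipBr) !(mxipZl, mxipZr) (mxipC D) WD.
(* The quadratic terms cancel, leaving exactly the slack of [WX]. *)
rewrite -subr_ge0 [leRHS](_ : _ = \sum_i s' 0 i - mxip W X) ?subr_ge0 //.
by field.
Qed.

End Optimality.

(** * The squared residual as a function of [lambda] *)

Section Discrepancy.
Context {R : realType} {m : nat}.
Context (s : 'I_m -> R) (s_ge0 : forall i, 0 <= s i).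

Let g lambda := \sum_i Num.min (s i) lambda ^+ 2.

Lemma continuous_sum_sqr_min : continuous g.
Proof.
apply: continuous_big => [|i _]; first exact: add_continuous.
move=> x; rewrite /continuous_at.
have c : {for x, continuous (fun l : R => Num.min (s i) l)}.
  by apply: (@continuous_min _ _ (cst (s i)) id); [exact: cst_continuous|].
by rewrite expr2; under eq_fun do rewrite expr2; exact: continuousM.
Qed.

Lemma sum_sqr_min_eq eta : 0 < eta -> eta < \sum_i s i ^+ 2 ->
  exists! lambda, 0 < lambda /\ g lambda = eta.
Proof.
move=> eta0 eta_lt; set M := \sum_i s i.
have sM i : s i <= M by rewrite /M (bigD1 i) //= lerDl sumr_ge0.
have M0 : 0 <= M by apply: sumr_ge0.
have g0 : g 0 = 0.
  by rewrite /g big1 // => i _; rewrite min_r // expr0n.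
have gM : g M = \sum_i s i ^+ 2.
  by apply: eq_bigr => i _; rewrite min_l.
have min_ge0 i z : 0 < z -> Num.min (s i) z \is Num.nneg.
  by move=> z0; rewrite nnegrE le_min s_ge0 ltW.
(* [g] is constant beyond the largest s_i, so strict growth is claimed only from a point where it
   equals [eta]. *)
have g_lt x y : 0 < x -> g x = eta -> x < y -> g x < g y.
  move=> x0 gx xy; have y0 := lt_trans x0 xy.
  have le_i i : Num.min (s i) x ^+ 2 <= Num.min (s i) y ^+ 2.
    rewrite ler_sqr ?min_ge0 // le_min !ge_min lexx (ltW xy).
    by rewrite orbT.
  (* Otherwise g x would be the full sum of squares, which exceeds [eta]. *)
  have [i xi] : exists i, x < s i.
    apply: contrapT => /forallNP h; move: eta_lt; rewrite -gx ltNge => /negP.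
    apply; rewrite le_eqVlt; apply/orP; left; apply/eqP.
    by apply: eq_bigr => i _; rewrite min_l // leNgt; apply/negP/h.
  rewrite /g (bigD1 i) //= [ltRHS](bigD1 i) //= ltr_leD ?ler_sum //.
  rewrite ltr_sqr ?min_ge0 //.
  by rewrite (min_r (ltW xi)) lt_min xi.
have [|l] := @IVT _ g 0 M eta M0 (continuous_subspaceT continuous_sum_sqr_min).
  by rewrite g0 gM ge_min le_max (ltW eta0) (ltW eta_lt) orbT.
rewrite in_itv /= => /andP[l_ge0 _] gl.
have l0 : 0 < l.
  rewrite lt_neqAle l_ge0 andbT; apply/eqP => l0.
  by move: eta0; rewrite -gl -l0 g0 ltxx.
exists l; split=> // l' [l'0 gl'].
case: (ltgtP l l') => // [/(g_lt _ _ l0 gl)|/(g_lt _ _ l'0 gl')];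
  by rewrite gl gl' ltxx.
Qed.

End Discrepancy.

(** * Unique minimiser and unique threshold *)

Theorem theorem4p2 (R : realType) (m n : nat) (hmn : (m <= n)%N)
    (Y : 'M[R]_(m, n)) (s : 'rV[R]_m)
    (u : 'I_m -> 'cV[R]_m) (v : 'I_m -> 'cV[R]_n) (hY : is_svd Y s u v)
    (eta : R) (heta : 0 < eta) (hYeta : eta < frobenius_norm Y ^+ 2) :
  (forall lambda : R, 0 < lambda ->
     unique (is_minimizer (svt_objective lambda Y)) (svt lambda s u v)) /\
  exists! lambda : R,
    0 < lambda /\ frobenius_norm (Y - svt lambda s u v) ^+ 2 = eta.
Proof.
have [_ s_ge0 hu hv YE] := hY; split.
  move=> lambda l0; have c0 : 0 < (2 * lambda)^-1 by rewrite invr_gt0 mulr_gt0.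
  have gap X : svt_objective lambda Y (svt lambda s u v) + (2 * lambda)^-1 *
      mxip (X - svt lambda s u v) (X - svt lambda s u v)
      <= svt_objective lambda Y X.
    by have [s' [u' [v' hX]]] := svd_exists X hmn; exact: svt_objective_gap hX.
  split=> [X|X Xmin].
    by apply: le_trans (gap X); rewrite lerDl mulr_ge0 ?mxip_ge0 // ltW.
  (* For a minimiser [X] the gap leaves no room for a positive distance to the thresholded
     matrix. *)
  apply/esym/eqP; rewrite -subr_eq0; apply/eqP/mxip_eq0/eqP.
  rewrite eq_le mxip_ge0 andbT -(pmulr_rle0 _ c0).
  have := gap X; have := Xmin (svt lambda s u v); lra.
have YY : mxip Y Y = \sum_i s 0 i ^+ 2.
  by rewrite YE; exact: (mxip_dyad_sum (s 0) (s 0) hu hv).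
rewrite sqr_frobenius_norm YY in hYeta.
have resE lambda : frobenius_norm (Y - svt lambda s u v) ^+ 2 =
    \sum_i Num.min (s 0 i) lambda ^+ 2.
  by rewrite sqr_frobenius_norm (svt_residual hY) mxip_dyad_sum.
have [lambda [[l0 hl] luniq]] := sum_sqr_min_eq s_ge0 heta hYeta.
exists lambda; split=> [|l [l0' hl']]; first by rewrite resE.
by apply: luniq; rewrite -resE.
Qed.
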